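(* Let $(A,\mathfrak m,k)$ be a noetherian commutative local ring with maximal ideal $\mathfrak m$ and residue field $k$. Let $M$ be a complex of free $A$-modules with $M_i=0$ for $i\notin[0,\dim A]$, such that the $A$-module $\operatorname{H}_0(M)$ is finitely generated and $\operatorname{length}_A\operatorname{H}_i(M)$ is finite for each $i\ge 1$. Assume that $A$ has a big Cohen-Macaulay module. If $k$ is (isomorphic to) a direct summand of the $A$-module $\operatorname{H}_0(M)$, then the local ring $A$ is regular.
   Context: Complexes are graded homologically (the differential lowers degree by one). The free modules $M_i$ are not assumed to have finite rank. $\dim A$ denotes Krull dimension. For an $A$-module $C$ (not necessarily finitely generated), a sequence $x_1,\dots,x_n$ of elements of $A$ is $C$-regular if $(x_1,\dots,x_n)C\ne C$ and, for each $1\le i\le n$, $x_i$ is a non-zero divisor on $C/(x_1,\dots,x_{i-1})C$. An $A$-module $C$ (not necessarily finitely generated) is big Cohen-Macaulay if there is a system of parameters for $A$ that is $C$-regular. *)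

(* Defs.v *)
From HB Require Import structures.
From mathcomp Require Import all_boot all_order all_algebra.
From mathcomp Require Import boolp.

Set Implicit Arguments.
Unset Strict Implicit.
Unset Printing Implicit Defensive.

Import Order.TTheory GRing.Theory Num.Theory.
Local Open Scope ring_scope.
Local Open Scope quotient_scope.

(* Submodules and ideals are the library's boolean closed predicates
   ([submodClosed V], [idealr A], [prime_idealr A]); with the classical axioms
   of boolp these are all submodules, all proper ideals and all prime ideals. *)

Section ModuleQuotient.
Variables (A : pzRingType) (V : lmodType A) (S : submodClosed V).

Definition submod_pred : {pred V} := fun x => x \in S.

HB.instance Definition _ := GRing.isZmodClosed.Build V submod_pred
  (GRing.subsemimod_closedB (GRing.subsemimodClosedP S)).

Definition modquot : Type :=
  Quotient.quot (GRing.ZmodClosed.clone V submod_pred _).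

HB.instance Definition _ := GRing.Zmodule.on modquot.
HB.instance Definition _ := EqQuotient.on modquot.

Definition modquot_scale (a : A) (q : modquot) : modquot :=
  \pi_modquot (a *: repr q).

Lemma modquot_eqP (x y : V) :
  (x == y %[mod modquot]) = (x - y \in S).
Proof. by rewrite -Quotient.idealrBE. Qed.

Lemma pi_modquotD (x y : V) :
  \pi_modquot (x + y) = \pi_modquot x + \pi_modquot y.
Proof. by rewrite !piE. Qed.

Lemma pi_modquotZ a (x : V) :
  \pi_modquot (a *: x) = modquot_scale a (\pi_modquot x).
Proof.
apply/eqP; rewrite modquot_eqP -scalerBr rpredZ //.
by rewrite -modquot_eqP reprK.
Qed.

Lemma modquot_scaleA a b q :
  modquot_scale a (modquot_scale b q) = modquot_scale (a * b) q.
Proof.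
rewrite -[q]reprK; move: (repr q) => x.
by rewrite -(pi_modquotZ b x) -(pi_modquotZ a) -(pi_modquotZ _ x) scalerA.
Qed.

Lemma modquot_scale1 : left_id 1 modquot_scale.
Proof. by move=> q; rewrite /modquot_scale scale1r reprK. Qed.

Lemma modquot_scaleDr : right_distributive modquot_scale +%R.
Proof.
move=> a p q; rewrite -[p]reprK -[q]reprK; move: (repr p) (repr q) => x y.
rewrite -pi_modquotD -(pi_modquotZ a (x + y)) scalerDr pi_modquotD.
by rewrite (pi_modquotZ a x) (pi_modquotZ a y).
Qed.

Lemma modquot_scaleDl q : {morph modquot_scale^~ q : a b / a + b}.
Proof. by move=> a b; rewrite /modquot_scale scalerDl pi_modquotD. Qed.

HB.instance Definition _ := GRing.Zmodule_isLmodule.Build A modquot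
  modquot_scaleA modquot_scale1 modquot_scaleDr modquot_scaleDl.

End ModuleQuotient.

Section Homology.
Variables (A : pzRingType) (U V W : lmodType A).
Variables (f : {linear U -> V}) (g : {linear V -> W}).

Definition ker_pred : {pred V} := fun x => g x == 0.

Lemma ker_pred_closed : subsemimod_closed ker_pred.
Proof.
split; first split; rewrite ?unfold_in /ker_pred ?linear0 //.
- move=> x y; rewrite !unfold_in /ker_pred => /eqP gx /eqP gy.
  by rewrite linearD gx gy addr0.
- move=> a x; rewrite !unfold_in /ker_pred => /eqP gx.
  by rewrite linearZ_LR gx scaler0.
Qed.

HB.instance Definition _ := GRing.isSubmodClosed.Build A V ker_pred
  ker_pred_closed.

Record cycles := Cycle { cycle_val : V; _ : cycle_val \in ker_pred }.

HB.instance Definition _ := [isSub for cycle_val].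
HB.instance Definition _ := [Choice of cycles by <:].
HB.instance Definition _ := [SubChoice_isSubLmodule of cycles by <:].

Definition bound_pred : {pred cycles} := fun z => `[< exists u, f u = cycle_val z >].

Lemma bound_pred_closed : subsemimod_closed bound_pred.
Proof.
split; first split; rewrite ?unfold_in.
- by apply/asboolP; exists 0; rewrite linear0.
- move=> x y /asboolP[u ux] /asboolP[v vy].
  by apply/asboolP; exists (u + v); rewrite linearD ux vy.
- move=> a x /asboolP[u ux].
  by apply/asboolP; exists (a *: u); rewrite linearZ_LR ux.
Qed.

HB.instance Definition _ := GRing.isSubmodClosed.Build A cycles bound_pred
  bound_pred_closed.

Definition ker_mod_im : lmodType A := modquot (GRing.SubmodClosed.clone A cycles bound_pred _).

End Homology.

(* Homologically graded complexes: [diff i j] is the differential M_i -> M_j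
   when j = i - 1, and zero otherwise. *)
Record complex (A : pzRingType) := Complex {
  obj :> int -> lmodType A;
  diff : forall i j : int, {linear obj i -> obj j};
  diff_shape : forall i j, j != i - 1 -> forall x, diff i j x = 0;
  diff_diff : forall i j k x, diff j k (diff i j x) = 0
}.

Definition homology (A : pzRingType) (M : complex A) (i : int) : lmodType A :=
  ker_mod_im (diff M (i + 1) i) (diff M i (i - 1)).

Section Modules.
Variable A : pzRingType.
Implicit Types U V : lmodType A.

Definition lin_comb V (vs : seq V) (x : V) : Prop :=
  exists c : 'I_(size vs) -> A, x = \sum_i c i *: vs`_i.

Definition fin_gen V : Prop := exists vs : seq V, forall x, lin_comb vs x.

Definition is_basis V (B : V -> Prop) : Prop :=
  (forall x, exists vs : seq V, (forall v, v \in vs -> B v) /\ lin_comb vs x)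
  /\ (forall (vs : seq V) (c : V -> A), uniq vs -> (forall v, v \in vs -> B v) ->
        \sum_(v <- vs) c v *: v = 0 -> forall v, v \in vs -> c v = 0).

Definition is_free V : Prop := exists B : V -> Prop, is_basis B.

Definition strict_chain (T : Type) (n : nat) (P : nat -> {pred T}) : Prop :=
  forall i, (i < n)%N ->
    {subset P i <= P i.+1} /\ exists2 x, x \in P i.+1 & x \notin P i.

(* length V = sup of the lengths of the strict chains of submodules *)
Definition finite_length V : Prop :=
  exists n : nat, forall (l : nat) (S : nat -> submodClosed V),
    strict_chain l S -> (l <= n)%N.

Definition direct_summand U V : Prop :=
  exists (N : lmodType A) (f : {linear (U * N)%type -> V}), bijective f.

End Modules.

Section LocalRing.
Variable A : comNzRingType.

Definition noetherian : Prop := forall I : submodClosed A^o,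
  exists xs : seq A^o, forall a, a \in I <-> lin_comb xs a.

Definition krull_dim (d : nat) : Prop :=
  (exists P : nat -> prime_idealr A, strict_chain d P) /\
  (forall (n : nat) (P : nat -> prime_idealr A), strict_chain n P -> (n <= d)%N).

Definition maximal_ideal (m : idealr A) : Prop :=
  forall J : idealr A, {subset m <= J} -> J =i m.

Definition local_ring (m : idealr A) : Prop :=
  maximal_ideal m /\ forall n : idealr A, maximal_ideal n -> n =i m.

Definition ideal_pred (m : idealr A) : {pred A^o} := fun a => a \in m.

Lemma ideal_pred_closed m : subsemimod_closed (ideal_pred m).
Proof.
by split; [split; [exact: rpred0|exact: rpredD]|move=> a x; exact: idealMr].
Qed.

HB.instance Definition _ m := GRing.isSubmodClosed.Build A A^o (ideal_pred m)
  (ideal_pred_closed m).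

Definition residue_field (m : idealr A) : lmodType A :=
  modquot (GRing.SubmodClosed.clone A A^o (ideal_pred m) _).

Definition gen_ideal (xs : seq A) (a : A) : Prop := lin_comb (xs : seq A^o) a.

Definition system_of_parameters (m : idealr A) (xs : seq A) : Prop :=
  [/\ krull_dim (size xs),
      {subset xs <= m}
    & forall a, a \in m -> exists n : nat, gen_ideal xs (a ^+ n)].

Definition regular_local (m : idealr A) : Prop :=
  exists xs : seq A, krull_dim (size xs) /\ forall a, a \in m <-> gen_ideal xs a.

Section RegularSequence.
Variable C : lmodType A.

(* the submodule (x_1, ..., x_n)C = x_1 C + ... + x_n C *)
Definition ext_pred (xs : seq A) : {pred C} :=
  fun c => `[< exists v : 'I_(size xs) -> C, c = \sum_(i < size xs) xs`_i *: v i >].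

Lemma ext_pred_closed xs : subsemimod_closed (ext_pred xs).
Proof.
split; first split; rewrite ?unfold_in.
- by apply/asboolP; exists (fun=> 0); rewrite big1 // => i _; rewrite scaler0.
- move=> x y /asboolP[u ->] /asboolP[v ->]; apply/asboolP.
  exists (fun i => u i + v i); rewrite -big_split /=.
  by apply: eq_bigr => i _; rewrite scalerDr.
- move=> a x /asboolP[u ->]; apply/asboolP.
  exists (fun i => a *: u i); rewrite scaler_sumr.
  by apply: eq_bigr => i _; rewrite !scalerA mulrC.
Qed.

HB.instance Definition _ xs := GRing.isSubmodClosed.Build A C (ext_pred xs)
  (ext_pred_closed xs).

Definition nonzerodivisor (V : lmodType A) (a : A) : Prop :=
  forall v : V, a *: v = 0 -> v = 0.

Definition regular_sequence (xs : seq A) : Prop :=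
  (exists c, c \notin ext_pred xs) /\
  (forall i, (i < size xs)%N ->
     nonzerodivisor (modquot (GRing.SubmodClosed.clone A C (ext_pred (take i xs)) _)) xs`_i).

End RegularSequence.

Definition big_cohen_macaulay (m : idealr A) (C : lmodType A) : Prop :=
  exists xs : seq A, system_of_parameters m xs /\ regular_sequence C xs.

End LocalRing.

(* Main.v *)
Require Import Defs.
From HB Require Import structures.
From mathcomp Require Import all_boot all_algebra.
From mathcomp Require Import finmap boolp classical_sets functions fsbigop.

Set Implicit Arguments.
Unset Strict Implicit.
Unset Printing Implicit Defensive.

Import GRing.Theory.
Local Open Scope ring_scope.

(** Let ys = y_1, ..., y_n be minimal generators of m; we show n <= dim A. Write
    X = M (x) C, and for a system of parameters xs regular on C consider
    Y = Hom(K(xs^N), X), K the Koszul complex. As X lives in degrees at most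
    dim A and xs^N is regular on every X_i, Y is exact in positive degrees.

    Let e in M_0 represent a generator of the summand k of H_0(M), and let
    d f_l = y_l e. Since m acts nilpotently on H_i(M) for i >= 1, the element e
    and the f_l extend, for N large, to a chain map K(xs^N) -> M and
    null-homotopies of its multiples by the y_l.

    Tensored with c_1, ..., c_n in C such that sum y_l c_l = 0, these
    null-homotopies form a cycle in Y_1, hence a boundary, and the retraction
    H_0(M) -> k turns this into c_l in mC for all l (that is, Tor_1(k, C) = 0).

    Tensored with c in C \ mC, they extend, by exactness of Y, to a chain map
    K(ys) -> Y -> X. As in Serre's argument for regularity, if its value on the
    product of the first j + 1 generators lies in mX + dX then, the relations
    of the y_l on X having coefficients in mX, so does its value on the product
    of the first j; but its value e (x) c in degree 0 does not. Hence
    X_n <> 0 and n <= dim A. *)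

(** * Submodules and weakly regular sequences *)

Section Packing.
Variable A : pzRingType.
Implicit Types U V : lmodType A.

Definition linear_of U V (f : U -> V) (f_lin : linear f) : {linear U -> V} :=
  HB.pack_for {linear U -> V} f (GRing.isLinear.Build A U V *:%R f f_lin).

Definition submod_of V (P : {pred V}) (P_closed : submod_closed P) :
    submodClosed V :=
  HB.pack_for (submodClosed V) P
    (GRing.isSubmodClosed.Build A V P (GRing.submod_closed_semi P_closed)).

End Packing.

Section Submodules.
Variables (A : comNzRingType) (U V : lmodType A).
Implicit Types (S T : submodClosed V) (x : A) (xs ys : seq A).

Lemma submodN S v : (- v \in S) = (v \in S).
Proof.
have sub u : u \in S -> - u \in S by move=> Su; rewrite -scaleN1r rpredZ.
by apply/idP/idP => /sub; rewrite ?opprK.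
Qed.

Lemma submodB S u v : u \in S -> v \in S -> u - v \in S.
Proof. by move=> Su Sv; rewrite rpredD ?submodN. Qed.

Lemma submodBC S u v : (u - v \in S) = (v - u \in S).
Proof. by rewrite -opprB submodN. Qed.

Lemma submod_trans S v u w : u - v \in S -> v - w \in S -> u - w \in S.
Proof. by move=> Suv Svw; rewrite -(subrK v u) -addrA rpredD. Qed.

Lemma submod_congr S u v : u - v \in S -> (u \in S) = (v \in S).
Proof.
move=> Suv; apply/idP/idP => [Su|Sv]; last by rewrite -(subrK v u) rpredD.
by rewrite -(subKr u v) submodB.
Qed.

Section Preimage.
Variables (f : {linear U -> V}) (S : submodClosed V).

Lemma preim_submod_closed : submod_closed [pred u | f u \in S].
Proof.
split=> [|a u v Su Sv]; first by rewrite inE linear0 rpred0.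
by rewrite inE linearP rpredD ?rpredZ.
Qed.

Definition preim_submod : submodClosed U := submod_of preim_submod_closed.

Lemma mem_preim_submod u : (u \in preim_submod) = (f u \in S).
Proof. by []. Qed.

End Preimage.

Section Adjoin.
Variables (S : submodClosed V) (x : A).

Lemma adjoin_closed :
  submod_closed [pred v | `[< exists w : V, v - x *: w \in S >]].
Proof.
split=> [|a u v].
  by apply/asboolP; exists 0; rewrite scaler0 subr0 rpred0.
move=> /asboolP[w Sw] /asboolP[w' Sw']; apply/asboolP; exists (a *: w + w').
rewrite scalerDr opprD addrACA rpredD // scalerA mulrC -scalerA -scalerBr.
exact: rpredZ.
Qed.

Definition adjoin : submodClosed V := submod_of adjoin_closed.

Lemma adjoinP v : reflect (exists w : V, v - x *: w \in S) (v \in adjoin).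
Proof. exact: asboolP. Qed.

Lemma sub_adjoin : {subset S <= adjoin}.
Proof. by move=> v Sv; apply/adjoinP; exists 0; rewrite scaler0 subr0. Qed.

Lemma mem_adjoin w : x *: w \in adjoin.
Proof. by apply/adjoinP; exists w; rewrite subrr rpred0. Qed.

Lemma adjoin_sub T :
  {subset S <= T} -> (forall w, x *: w \in T) -> {subset adjoin <= T}.
Proof. by move=> ST xT v /adjoinP[w /ST /submod_congr ->]. Qed.

End Adjoin.

Lemma eq_adjoin S T x : S =i T -> adjoin S x =i adjoin T x.
Proof.
move=> ST v; apply/idP/idP; apply: adjoin_sub => [u|w]; rewrite ?mem_adjoin //.
  by rewrite ST; exact: sub_adjoin.
by rewrite -ST; exact: sub_adjoin.
Qed.

Lemma adjoinC S x y : adjoin (adjoin S x) y =i adjoin (adjoin S y) x.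
Proof.
have sub z z' : {subset adjoin (adjoin S z) z' <= adjoin (adjoin S z') z}.
  apply: adjoin_sub => [|w]; last exact/sub_adjoin/mem_adjoin.
  by apply: adjoin_sub => [v Sv|w]; rewrite ?mem_adjoin // !sub_adjoin.
by move=> v; apply/idP/idP; exact: sub.
Qed.

Definition ext_submod xs : submodClosed V :=
  GRing.SubmodClosed.clone A V (ext_pred xs) _.

Lemma ext_submod_nil v : (v \in ext_submod [::]) = (v == 0).
Proof.
apply/asboolP/eqP => [[u ->]|->]; first by rewrite big_ord0.
by exists (fun=> 0); rewrite big_ord0.
Qed.

Lemma mem_ext_submod x xs v : x \in xs -> x *: v \in ext_submod xs.
Proof.
rewrite -index_mem => lt_x; apply/asboolP.
exists (fun i => if i == Ordinal lt_x then v else 0).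
rewrite (bigD1 (Ordinal lt_x)) //= eqxx nth_index -?index_mem // big1 ?addr0 //.
by move=> i /negPf ->; rewrite scaler0.
Qed.

Lemma ext_submod_sub xs S :
  (forall x v, x \in xs -> x *: v \in S) -> {subset ext_submod xs <= S}.
Proof.
by move=> xS _ /asboolP[u ->]; apply: rpred_sum => i _; rewrite xS ?mem_nth.
Qed.

Lemma adjoin_ext_submod x xs ys :
  ys =i x :: xs -> adjoin (ext_submod xs) x =i ext_submod ys.
Proof.
move=> ysE v; apply/idP/idP.
  apply: adjoin_sub => [|w]; last by rewrite mem_ext_submod // ysE mem_head.
  apply: ext_submod_sub => y u xs_y.
  by rewrite mem_ext_submod // ysE inE xs_y orbT.
apply: ext_submod_sub => y u; rewrite ysE inE => /predU1P[->|xs_y].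
  exact: mem_adjoin.
exact/sub_adjoin/mem_ext_submod.
Qed.

End Submodules.

Section ExtendedIdeals.
Variable A : comNzRingType.
Implicit Types (U V : lmodType A) (a : A) (xs ys : seq A).

Lemma seq_sub_ext_submod xs : {subset xs <= ext_submod A^o xs}.
Proof.
move=> x xs_x; rewrite -[x]mulr1; exact: (mem_ext_submod (1 : A^o) xs_x).
Qed.

Lemma linear_ext_submod U V (f : {linear U -> V}) xs u :
  u \in ext_submod U xs -> f u \in ext_submod V xs.
Proof.
rewrite -(mem_preim_submod f); apply: ext_submod_sub => x v xs_x.
by rewrite mem_preim_submod linearZ_LR mem_ext_submod.
Qed.

Lemma scale_linear V (v : V) : linear (fun a : A^o => a *: v).
Proof. by move=> a b c; rewrite scalerDl -scalerA. Qed.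

Definition scale_at V (v : V) : {linear A^o -> V} := linear_of (scale_linear v).

Lemma ext_submodZ V xs a (v : V) :
  a \in ext_submod A^o xs -> a *: v \in ext_submod V xs.
Proof. exact: (linear_ext_submod (scale_at v)). Qed.

Lemma gen_idealP xs a : gen_ideal xs a <-> a \in ext_submod A^o xs.
Proof.
by split=> [[c ->]|/asboolP[c ->]]; [apply/asboolP|]; exists c;
  apply: eq_bigr => i _; exact: mulrC.
Qed.

(* When [xs] minimally generates the maximal ideal of a local ring with residue
   field k, this says that Tor_1(k, V) = 0. *)
Definition syzygies_in_ext xs V := forall v : 'I_(size xs) -> V,
  \sum_(i < size xs) xs`_i *: v i = 0 -> forall i, v i \in ext_submod V xs.

End ExtendedIdeals.

Section WeaklyRegular.
Variables (A : comNzRingType) (V : lmodType A).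
Implicit Types (S T : submodClosed V) (x y z : A) (xs : seq A).

Definition regular_mod S x := forall v, x *: v \in S -> v \in S.

(* [xs] is a weakly regular sequence on V/S. *)
Fixpoint weakly_regular S xs : Prop :=
  if xs is x :: xs' then regular_mod S x /\ weakly_regular (adjoin S x) xs'
  else True.

Lemma eq_weakly_regular S T xs :
  S =i T -> weakly_regular S xs -> weakly_regular T xs.
Proof.
elim: xs S T => [|x xs IH] S T ST //= [Sx Sxs]; split.
  by move=> v; rewrite -!ST; exact: Sx.
exact: IH (eq_adjoin x ST) Sxs.
Qed.

Lemma regular_mod_pow S x N : regular_mod S x -> regular_mod S (x ^+ N).
Proof.
move=> Sx; elim: N => [|N IH] v; first by rewrite scale1r.
by rewrite exprS -scalerA => /Sx/IH.
Qed.

Lemma regular_mod_swap S x z :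
  regular_mod S x -> regular_mod (adjoin S x) z -> regular_mod (adjoin S z) x.
Proof.
move=> Sx Sz v /adjoinP[w Sw].
have /Sz/adjoinP[w' Sw'] : z *: w \in adjoin S x.
  by apply/adjoinP; exists v; rewrite submodBC.
apply/adjoinP; exists w'; apply: Sx; rewrite scalerBr.
by apply: submod_trans Sw _; rewrite scalerA mulrC -scalerA -scalerBr rpredZ.
Qed.

Lemma regular_mod_adjoin_pow S x z N : regular_mod S x ->
  regular_mod (adjoin S x) z -> regular_mod (adjoin S (x ^+ N.+1)) z.
Proof.
move=> Sx Sz; elim: N => [|N IH] //= v zv.
have [w Sw] : exists w, v - x *: w \in S.
  apply/adjoinP/Sz; apply: adjoin_sub zv; first exact: sub_adjoin.
  by move=> w; rewrite exprS -scalerA mem_adjoin.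
have /IH/adjoinP[w' Sw'] : z *: w \in adjoin S (x ^+ N.+1).
  have /adjoinP[u Su] := zv; apply/adjoinP; exists u; apply: Sx.
  rewrite scalerBr !scalerA -exprS; apply: submod_trans Su.
  by rewrite mulrC -scalerA -scalerBr rpredZ // submodBC.
apply/adjoinP; exists w'; apply: submod_trans Sw _.
by rewrite exprS -scalerA -scalerBr rpredZ.
Qed.

(* The induction on [xs] replaces S by S + zV, modulo which x :: xs is again
   weakly regular. *)
Lemma weakly_regular_pow_head S x xs N :
  weakly_regular S (x :: xs) -> weakly_regular S (x ^+ N.+1 :: xs).
Proof.
elim: xs S => [|z xs IH] S /= [Sx]; first by split=> //; exact: regular_mod_pow.
move=> [Sz Sxs]; split; first exact: regular_mod_pow.
split; first exact: regular_mod_adjoin_pow.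
apply: eq_weakly_regular (adjoinC _ _ _) _; apply: (IH _ _).2; split.
  exact: regular_mod_swap.
exact: eq_weakly_regular (adjoinC _ _ _) Sxs.
Qed.

(* The exponents are shifted by one so as to be positive. *)
Fixpoint pow_seq xs (Ns : seq nat) : seq A :=
  if (xs, Ns) is (x :: xs', N :: Ns') then x ^+ N.+1 :: pow_seq xs' Ns'
  else [::].

Lemma size_pow_seq xs Ns : size Ns = size xs -> size (pow_seq xs Ns) = size xs.
Proof. by elim: xs Ns => [|x xs IH] [|N Ns] //= [/IH ->]. Qed.

Lemma weakly_regular_pow S xs Ns :
  weakly_regular S xs -> weakly_regular S (pow_seq xs Ns).
Proof.
elim: xs Ns S => [|x xs IH] [|N Ns] S // /(weakly_regular_pow_head N)[Sx Sxs].
by split=> //; exact: IH.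
Qed.

End WeaklyRegular.

Lemma weakly_regular_preim (A : comNzRingType) (U V : lmodType A)
    (f : {linear U -> V}) (S : submodClosed V) xs :
  (forall v, exists u, f u = v) ->
  weakly_regular S xs -> weakly_regular (preim_submod f S) xs.
Proof.
move=> f_surj; elim: xs S => [|x xs IH] S //= [Sx Sxs]; split.
  by move=> u; rewrite !mem_preim_submod linearZ_LR; exact: Sx.
apply: eq_weakly_regular (IH _ Sxs) => u; apply/idP/idP.
  move=> /adjoinP[w]; have [u' <-] := f_surj w => Suu'; apply/adjoinP.
  by exists u'; rewrite mem_preim_submod linearB linearZ_LR.
apply: adjoin_sub => [u' Su'|u']; rewrite mem_preim_submod.
  exact: sub_adjoin.
by rewrite linearZ_LR mem_adjoin.
Qed.

Section QuotientProjection.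
Local Open Scope quotient_scope.
Variables (A : pzRingType) (V : lmodType A) (S : submodClosed V).

Definition quot_pi (v : V) : modquot S := \pi_(modquot S) v.

Lemma quot_pi_linear : linear quot_pi.
Proof. by move=> a u v; rewrite /quot_pi pi_modquotD pi_modquotZ. Qed.

HB.instance Definition _ := GRing.isLinear.Build A _ _ _ quot_pi quot_pi_linear.

Lemma quot_pi_eq0 v : (quot_pi v == 0) = (v \in S).
Proof. by rewrite -[0](linear0 quot_pi) modquot_eqP subr0. Qed.

Lemma quot_pi_surj q : exists v, quot_pi v = q.
Proof. by exists (repr q); exact: reprK. Qed.

End QuotientProjection.

Lemma nonzerodivisor_regular_mod (A : comNzRingType) (V : lmodType A)
    (S : submodClosed V) x :
  nonzerodivisor (modquot S) x -> regular_mod S x.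
Proof.
by move=> x_reg v; rewrite -!quot_pi_eq0 linearZ_LR => /eqP/x_reg/eqP.
Qed.

Lemma regular_sequence_weakly_regular (A : comNzRingType) (C : lmodType A) xs :
  regular_sequence C xs -> weakly_regular (ext_submod C [::]) xs.
Proof.
move=> [_ reg].
suff reg_suffix pre suf : pre ++ suf = xs ->
    weakly_regular (ext_submod C pre) suf by exact: (reg_suffix [::]).
elim: suf pre => [//|x suf IH] pre Exs; split.
  have := reg (size pre); rewrite -Exs take_size_cat // nth_cat ltnn subnn /=.
  rewrite size_cat /= addnS ltnS leq_addr => /(_ isT).
  exact: nonzerodivisor_regular_mod.
apply: eq_weakly_regular (IH (rcons pre x) _); last by rewrite cat_rcons.
by move=> c; apply/esym/adjoin_ext_submod/mem_rcons.
Qed.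

(** * Koszul complexes as iterated cocones *)

Section ChainComplexes.
Variable A : comNzRingType.

Record chain := Chain {
  chain_obj :> nat -> lmodType A;
  bdry : forall i, {linear chain_obj i.+1 -> chain_obj i};
  bdry_bdry : forall i x, bdry i (bdry i.+1 x) = 0
}.
Arguments bdry {_ _}.
Implicit Types (M X : chain) (x : A) (xs : seq A).

Definition exact_pos X :=
  forall i (z : X i.+1), bdry z = 0 -> exists w : X i.+2, z = bdry w.

Definition nilpotent_on_homology X x := forall i, exists N, forall z : X i.+1,
  bdry z = 0 -> exists w : X i.+2, x ^+ N *: z = bdry w.

Section Cocone.
Variables (x : A) (X : chain).

Definition cocone_bdry i (z : (X i.+1 * X i.+2)%type) : (X i * X i.+1)%type :=
  (bdry z.1, x *: z.1 - bdry z.2).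

Lemma cocone_bdry_linear i : linear (@cocone_bdry i).
Proof.
move=> a [u v] [u' v']; rewrite /cocone_bdry /=; congr (_, _).
  by rewrite linearP.
by rewrite linearP /= scalerBr !scalerDr opprD addrACA !scalerA [x * a]mulrC.
Qed.

HB.instance Definition _ i := GRing.isLinear.Build A _ _ _ (@cocone_bdry i)
  (@cocone_bdry_linear i).

Lemma cocone_bdry_bdry i z : @cocone_bdry i (@cocone_bdry i.+1 z) = 0.
Proof.
by rewrite /cocone_bdry /= linearB linearZ_LR /= !bdry_bdry subr0 subrr.
Qed.

Definition cocone : chain := Chain cocone_bdry_bdry.

Lemma cocone_exact_pos : exact_pos X -> exact_pos cocone.
Proof.
move=> exX i [a b] /= [] da /subr0_eq db; rewrite /= in a b da db *.
have [a' Ea] := exX _ _ da.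
have [|b' Eb] := exX _ (x *: a' - b).
  by rewrite linearB linearZ_LR -Ea db subrr.
by exists (a', b'); rewrite /= /cocone_bdry /= -Ea -Eb opprB addrC subrK.
Qed.

Lemma cocone_nilpotent_on_homology y :
  nilpotent_on_homology X y -> nilpotent_on_homology cocone y.
Proof.
move=> nilX i; have [N yN] := nilX i; have [N' yN'] := nilX i.+1.
exists (N' + N)%N => -[a b] [/= da /subr0_eq dab].
have [a' Ea'] := yN _ da.
have [|b' Eb'] := yN' (y ^+ N *: b - x *: a').
  by rewrite linearB !linearZ_LR /= -dab -Ea' scalerN !scalerA mulrC subrr.
exists (y ^+ N' *: a', - b'); congr (_, _).
  by rewrite /= linearZ_LR -Ea' scalerA exprD.
rewrite /= linearN opprK -Eb' scalerBr !scalerA -exprD [x * _]mulrC.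
by rewrite addrC subrK.
Qed.

End Cocone.

(* The complex Hom(K(xs), X), K(xs) the Koszul complex, cut off below 0. *)
Fixpoint koszul_hom xs X : chain :=
  if xs is x :: xs' then koszul_hom xs' (cocone x X) else X.

Fixpoint koszul_eval xs X i : koszul_hom xs X i -> X i :=
  match xs return koszul_hom xs X i -> X i with
  | [::] => id
  | x :: xs' => fun z => (@koszul_eval xs' (cocone x X) i z).1
  end.

Lemma koszul_eval_linear xs X i : linear (@koszul_eval xs X i).
Proof. by elim: xs X => [|x xs IH] X a u v //=; rewrite IH. Qed.

HB.instance Definition _ xs X i := GRing.isLinear.Build A _ _ _
  (@koszul_eval xs X i) (@koszul_eval_linear xs X i).

Lemma koszul_eval_bdry xs X i (z : koszul_hom xs X i.+1) :
  koszul_eval (bdry z) = bdry (koszul_eval z).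
Proof. by elim: xs X z => [|x xs IH] X z //=; rewrite IH. Qed.

Record subcomplex X := Subcomplex {
  subcomplex_obj :> forall i, submodClosed (X i);
  subcomplex_bdry : forall i (u : X i.+1),
    u \in subcomplex_obj i.+1 -> bdry u \in subcomplex_obj i
}.

Definition exact_on X (T : subcomplex X) :=
  forall i (z : X i.+1), z \in T i.+1 -> bdry z = 0 ->
  exists2 w : X i.+2, w \in T i.+2 & z = bdry w.

Lemma zero_subcomplex_bdry X i (u : X i.+1) :
  u \in ext_submod (X i.+1) [::] -> bdry u \in ext_submod (X i) [::].
Proof. by rewrite !ext_submod_nil => /eqP ->; rewrite linear0. Qed.

Definition zero_subcomplex X : subcomplex X :=
  Subcomplex (@zero_subcomplex_bdry X).

Lemma exact_on_zero X : exact_on (zero_subcomplex X).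
Proof.
move=> i z; rewrite ext_submod_nil => /eqP -> _; exists 0; first exact: rpred0.
by rewrite linear0.
Qed.

Section CoconeSubcomplex.
Variables (x : A) (X : chain) (T : subcomplex X).

Definition cocone_submod i : submodClosed (cocone x X i) :=
  preim_submod (snd : {linear (X i * X i.+1)%type -> X i.+1})
    (adjoin (T i.+1) x).

Lemma cocone_subcomplex_bdry i (u : cocone x X i.+1) :
  u \in cocone_submod i.+1 -> bdry u \in cocone_submod i.
Proof.
rewrite !mem_preim_submod /= => /adjoinP[w Tw]; apply/adjoinP.
exists (u.1 - bdry w); rewrite scalerBr opprB addrC subrKA -linearZ_LR -linearB.
by apply: subcomplex_bdry; rewrite submodBC.
Qed.

Definition cocone_subcomplex : subcomplex (cocone x X) :=
  Subcomplex cocone_subcomplex_bdry.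

Lemma mem_cocone_subcomplex i (z : cocone x X i) :
  (z \in cocone_subcomplex i) = (z.2 \in adjoin (T i.+1) x).
Proof. by []. Qed.

(* Modulo the boundary of (w, 0), a cycle (a, b) with b = t + x w, t in T, has
   b in T; then x a = db lies in T, and so does a. *)
Lemma cocone_exact_on :
  (forall i, regular_mod (T i) x) -> exact_on T -> exact_on cocone_subcomplex.
Proof.
move=> x_reg exT i [a b]; rewrite mem_cocone_subcomplex /= => /adjoinP[w].
move: (b - x *: w) (subrK (x *: w) b) => t <- Tt [/= da /subr0_eq xa].
have [||a' Ta' Ea] := exT _ (a - bdry w).
- apply: x_reg; rewrite scalerBr xa linearD linearZ_LR addrK.
  exact: subcomplex_bdry.
- by rewrite linearB da bdry_bdry subr0.
have [||b' Tb' Eb] := exT _ (x *: a' - t).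
- by rewrite submodB ?rpredZ.
- rewrite linearB linearZ_LR /= -Ea scalerBr xa linearD linearZ_LR addrK.
  by rewrite subrr.
exists (w + a', b'); first by rewrite mem_cocone_subcomplex sub_adjoin.
rewrite /= /cocone_bdry /= linearD -Ea -Eb scalerDr opprB; congr (_, _).
  by rewrite addrC subrK.
by rewrite [RHS]addrC [_ + x *: a']addrC subrKA.
Qed.

End CoconeSubcomplex.

Lemma koszul_hom_exact_pos_on xs X (T : subcomplex X) :
  exact_on T -> (forall i, weakly_regular (T i) xs) ->
  (forall i (v : X i), (size xs < i)%N -> v \in T i) ->
  exact_pos (koszul_hom xs X).
Proof.
elim: xs X T => [|x xs IH] X T exT Treg Tbig /=.
  by move=> i z /exT[|w _ ->]; [exact: Tbig|exists w].
apply: (IH _ (cocone_subcomplex x T)) => [|i|i v lt_i].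
- by apply: cocone_exact_on exT => i; exact: (Treg i).1.
- by apply: weakly_regular_preim (Treg i.+1).2 => v; exists (0, v).
by rewrite mem_cocone_subcomplex; apply/sub_adjoin/Tbig.
Qed.

Lemma koszul_hom_exact_pos xs X :
  (forall i, weakly_regular (ext_submod (X i) [::]) xs) ->
  (forall i (v : X i), (size xs < i)%N -> v = 0) ->
  exact_pos (koszul_hom xs X).
Proof.
move=> Xreg X0; apply: koszul_hom_exact_pos_on (@exact_on_zero X) Xreg _.
by move=> i v lt_i; rewrite ext_submod_nil; exact/eqP/X0.
Qed.

Section Pairing.
Variable C : lmodType A.

Record chain_pairing M X := ChainPairing {
  pairing :> forall i, {bilinear M i -> C -> X i};
  pairing_bdry : forall i (v : M i.+1) c,
    bdry (pairing i.+1 v c) = pairing i (bdry v) c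
}.

Section CoconePairing.
Variables (x : A) (M X : chain) (t : chain_pairing M X).

Definition cocone_pair i (z : cocone x M i) (c : C) : cocone x X i :=
  (t i z.1 c, t i.+1 z.2 c).

Lemma cocone_pair_bilinear i : bilinear_for *:%R *:%R (@cocone_pair i).
Proof.
split=> [c a u v|z a c c']; rewrite /cocone_pair /=.
  by rewrite !linearPl.
by rewrite !linearPr.
Qed.

HB.instance Definition _ i := bilinear_isBilinear.Build A _ _ _ _ _
  (@cocone_pair i) (@cocone_pair_bilinear i).

Lemma cocone_pair_bdry i (z : cocone x M i.+1) c :
  bdry (cocone_pair z c) = cocone_pair (bdry z) c.
Proof.
rewrite /= /cocone_bdry /cocone_pair /= !pairing_bdry.
by rewrite linearBl linearZl_LR.
Qed.

Definition cocone_pairing : chain_pairing (cocone x M) (cocone x X) :=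
  ChainPairing cocone_pair_bdry.

End CoconePairing.

Fixpoint koszul_pairing xs M X (t : chain_pairing M X) :
    chain_pairing (koszul_hom xs M) (koszul_hom xs X) :=
  match xs with
  | [::] => t
  | x :: xs' => koszul_pairing xs' (cocone_pairing x t)
  end.

Lemma koszul_eval_pairing xs M X (t : chain_pairing M X) i z c :
  koszul_eval (koszul_pairing xs t i z c) = t i (koszul_eval z) c.
Proof. by elim: xs M X t z => [|x xs IH] M X t z //=; rewrite IH. Qed.

End Pairing.

End ChainComplexes.

Arguments bdry {_ _ _}.

(** * Lifting along Koszul complexes *)

Section KoszulLifting.
Variables (A : comNzRingType) (ys : seq A).
Local Notation n := (size ys).
Implicit Types (X : chain A) (x : A) (xs : seq A).

Lemma cocone_lift X (e : X 0%N) (f : 'I_n -> X 1%N) (h : X 1%N) x N :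
  (forall l, bdry (f l) = ys`_l *: e) -> bdry h = x *: e ->
  (forall z : X 1%N, bdry z = 0 -> exists w : X 2%N, x ^+ N *: z = bdry w) ->
  exists2 g : 'I_n -> cocone (x ^+ N.+1) X 1%N, forall l, (g l).1 = f l
    & forall l, bdry (g l) = ys`_l *: ((e, x ^+ N *: h) : cocone _ X 0%N).
Proof.
move=> df dh nil.
have /choice[w Ew] l :
    exists w : X 2%N, x ^+ N *: (x *: f l - ys`_l *: h) = bdry w.
  apply: nil; rewrite linearB !linearZ_LR /= df dh.
  by rewrite scalerN !scalerA mulrC subrr.
exists (fun l => (f l, w l)) => // l; rewrite /= /cocone_bdry /= df -Ew.
by congr (_, _); rewrite scalerBr !scalerA -exprSr subKr mulrC.
Qed.

Lemma koszul_lift xs X (e : X 0%N) (f : 'I_n -> X 1%N) :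
  (forall l, bdry (f l) = ys`_l *: e) ->
  {subset xs <= ext_submod A^o ys} ->
  (forall x, x \in xs -> nilpotent_on_homology X x) ->
  exists2 Ns, size Ns = size xs &
    exists (p : koszul_hom (pow_seq xs Ns) X 0%N)
           (s : 'I_n -> koszul_hom (pow_seq xs Ns) X 1%N),
    [/\ koszul_eval p = e, forall l, koszul_eval (s l) = f l
      & forall l, bdry (s l) = ys`_l *: p].
Proof.
elim: xs X e f => [|x xs IH] X e f df gen_xs nil_xs.
  by exists [::] => //; exists e, f.
have /asboolP[a Ex] := gen_xs x (mem_head _ _).
have [N xN] := nil_xs x (mem_head _ _) 0%N.
have dh : bdry (\sum_l a l *: f l) = x *: e.
  rewrite linear_sum Ex scaler_suml; apply: eq_bigr => l _.
  by rewrite linearZ_LR /= df scalerA mulrC.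
have [g g1 dg] := cocone_lift df dh xN.
have [x' xs_x'|x' xs_x'|Ns sz_Ns [p [s [evp evs ds]]]] := IH _ _ g dg.
- by apply: gen_xs; rewrite inE xs_x' orbT.
- by apply/cocone_nilpotent_on_homology/nil_xs; rewrite inE xs_x' orbT.
exists (N :: Ns); first by rewrite /= sz_Ns.
by exists p, s; split=> //= [|l]; rewrite (evp, evs).
Qed.

(* The values, up to sign, of a chain map K(ys) -> X on the products of the
   first j generators listed in [s] form such a ladder. *)
Definition koszul_ladder (s : seq 'I_n) X (p : forall j, X j) :=
  forall j, (j < size s)%N -> exists2 l, l \in s &
  exists2 u : 'I_n -> X j,
    u l = p j & bdry (p j.+1) = \sum_(i < n) ys`_i *: u i.

Lemma exists_koszul_ladder (s : seq 'I_n) X (e : X 0%N) (f : 'I_n -> X 1%N) :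
  uniq s -> exact_pos X -> (forall l, bdry (f l) = ys`_l *: e) ->
  exists2 p : forall j, X j, p 0%N = e & koszul_ladder s p.
Proof.
elim: s X e f => [|k s IH] X e f /=.
  by move=> _ _ _; exists (fun j => if j is 0%N then e else 0).
move=> /andP[ks uniq_s] exX df.
have single (V : lmodType A) (v : V) :
    ys`_k *: v = \sum_(i < n) ys`_i *: ((i == k)%:R *: v).
  rewrite (bigD1 k) //= eqxx scale1r big1 ?addr0 // => i /negPf ->.
  by rewrite scale0r scaler0.
have nil (z : X 1%N) : bdry z = 0 -> exists w : X 2%N, ys`_k ^+ 0 *: z = bdry w.
  by move=> /exX[w Ez]; exists w; rewrite scale1r.
have [g g1 dg] := cocone_lift df (df k) nil.
have [P P0 ladderP] := IH _ _ g uniq_s (cocone_exact_pos exX) dg.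
(* The sign undoes the one in front of [bdry z.2] in [cocone_bdry]. *)
exists (fun j => if j is i.+1 then (-1) ^+ i *: (P i).2 else e) => // -[_|j].
  exists k; first exact: mem_head.
  exists (fun i => (i == k)%:R *: e); first by rewrite eqxx scale1r.
  by rewrite expr0 scale1r P0 /= expr0 scale1r df single.
rewrite /= ltnS => /ladderP[l sl [u ul dP]].
exists l; first by rewrite inE sl orbT.
exists (fun i => (-1) ^+ j.+1 *: ((i == k)%:R *: (P j.+1).1 - (u i).2)).
  have /negPf-> : l != k by apply: contra ks => /eqP <-.
  by rewrite ul scale0r sub0r exprS mulN1r scalerN scaleNr opprK.
have /eqP := congr1 snd dP; rewrite /= subr_eq addrC -subr_eq => /eqP dP2.
rewrite linearZ_LR /= -dP2 expr1 (raddf_sum snd) single -sumrB scaler_sumr.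
by apply: eq_bigr => i _; rewrite -scalerBr !scalerA mulrC.
Qed.

Lemma koszul_ladder_eval (s : seq 'I_n) xs X
    (p : forall j, koszul_hom xs X j) :
  koszul_ladder s p -> koszul_ladder s (fun j => koszul_eval (p j)).
Proof.
move=> ladder_p j /ladder_p[l sl [u ul dp]]; exists l => //.
exists (fun i => koszul_eval (u i)); first by rewrite ul.
rewrite -koszul_eval_bdry dp linear_sum; apply: eq_bigr => i _.
by rewrite linearZ_LR.
Qed.

(* If p_(j+1) = sum_i y_i v_i + dw and d p_(j+1) = sum_i y_i u_i with u_l = p_j,
   then the u_i - d v_i are the coefficients of a relation among the y_i. *)
Lemma koszul_ladder_descent (s : seq 'I_n) X (p : forall j, X j) :
  (forall i, syzygies_in_ext ys (X i)) -> koszul_ladder s p ->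
  (exists w, p (size s) - bdry w \in ext_submod (X (size s)) ys) ->
  exists w, p 0%N - bdry w \in ext_submod (X 0%N) ys.
Proof.
move=> X_syz ladder_p.
suff descent j : (j <= size s)%N ->
    (exists w, p j - bdry w \in ext_submod (X j) ys) ->
    exists w, p 0%N - bdry w \in ext_submod (X 0%N) ys by exact: descent.
elim: j => [//|j IH] lt_j [w /asboolP[v Ev]]; apply: IH; first exact: ltnW.
have [l _ [u ul dp]] := ladder_p j lt_j; exists (v l); rewrite -ul.
apply: (X_syz j (fun i => u i - bdry (v i))).
under eq_bigr do rewrite scalerBr -linearZ_LR.
rewrite sumrB -dp -linear_sum -Ev linearB bdry_bdry subr0.
exact: subrr.
Qed.

End KoszulLifting.

(** * Tensor products with free modules *)

Section FinitelySupported.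
Local Open Scope fset_scope.
Variables (A : comNzRingType) (B : choiceType) (C : lmodType A).

Definition finsupp_pred : {pred B -> C} :=
  fun w => `[< exists D : {fset B}, forall b, b \notin D -> w b = 0 >].

Lemma finsupp_closed : submod_closed finsupp_pred.
Proof.
split=> [|a u v]; first by apply/asboolP; exists fset0.
move=> /asboolP[D uD] /asboolP[D' vD']; apply/asboolP; exists (D `|` D') => b.
rewrite in_fsetU negb_or => /andP[/uD ub /vD' vb].
by rewrite addrfctE scalrfctE ub vb scaler0 addr0.
Qed.

HB.instance Definition _ := GRing.isSubmodClosed.Build A (B -> C) finsupp_pred
  (GRing.submod_closed_semi finsupp_closed).

Record finsupp_fun :=
  FinsuppFun { finsupp_val :> B -> C; _ : finsupp_val \in finsupp_pred }.

HB.instance Definition _ := [isSub for finsupp_val].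
HB.instance Definition _ := [Choice of finsupp_fun by <:].
HB.instance Definition _ := [SubChoice_isSubLmodule of finsupp_fun by <:].

Implicit Types (w : finsupp_fun) (D : {fset B}).

Lemma finsupp_funP w w' : (forall b, w b = w' b) -> w = w'.
Proof. by move=> ww'; apply/val_inj/funext. Qed.

Definition coef b w : C := w b.

Lemma coef_linear b : linear (coef b).
Proof. by []. Qed.

HB.instance Definition _ b :=
  GRing.isLinear.Build A _ _ _ (coef b) (coef_linear b).

Lemma exists_supp w : exists D, forall b, b \notin D -> w b = 0.
Proof. exact/asboolP/(valP w). Qed.

Definition finsupp_restrict D (u : B -> C) : finsupp_fun :=
  insubd 0 (fun b => if b \in D then u b else 0).

Lemma finsupp_restrictE D u b :
  finsupp_restrict D u b = if b \in D then u b else 0.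
Proof.
rewrite /finsupp_restrict insubdK //; apply/asboolP; exists D => b'.
by move=> /negPf ->.
Qed.

Lemma finsupp_fun_ind (S : submodClosed finsupp_fun) :
  (forall b c, finsupp_restrict [fset b] (fun=> c) \in S) -> forall w, w \in S.
Proof.
move=> singleS w; have [D wD] := exists_supp w.
have -> : w = \sum_(b <- D) finsupp_restrict [fset b] (fun=> w b).
  apply: finsupp_funP => b; rewrite -[RHS]/(coef b _) linear_sum /=.
  under eq_bigr do rewrite /coef finsupp_restrictE in_fset1 eq_sym.
  have [bD|bD] := boolP (b \in D).
    rewrite (bigD1_seq b) ?fset_uniq //= eqxx big1 ?addr0 //.
    by move=> b' /negPf ->.
  rewrite wD // big_seq big1 // => b' b'D; case: eqP => // Eb.
  by rewrite -Eb b'D in bD.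
exact: rpred_sum.
Qed.

Section Lift.
Variables (U : lmodType A) (h : B -> {linear C -> U}).

Definition finsupp_lift w : U := \sum_(b \in [set: B]%classic) h b (w b).

Lemma finsupp_liftE w D : (forall b, b \notin D -> w b = 0) ->
  finsupp_lift w = \sum_(b <- D) h b (w b).
Proof. by move=> wD; apply: fsbigTE => b /wD ->; rewrite linear0. Qed.

Lemma finsupp_lift_linear : linear finsupp_lift.
Proof.
move=> a u v; have [[D uD] [D' vD']] := (exists_supp u, exists_supp v).
have uDD' b : b \notin D `|` D' -> u b = 0.
  by rewrite in_fsetU negb_or => /andP[/uD].
have vDD' b : b \notin D `|` D' -> v b = 0.
  by rewrite in_fsetU negb_or => /andP[_ /vD'].
rewrite (finsupp_liftE uDD') (finsupp_liftE vDD').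
rewrite (finsupp_liftE (D := D `|` D')) => [|b bDD'].
  rewrite scaler_sumr -big_split; apply: eq_bigr => b _.
  exact: linearP.
by rewrite -[LHS]/(coef b _) linearP /= /coef uDD' ?vDD' // scaler0 addr0.
Qed.

HB.instance Definition _ :=
  GRing.isLinear.Build A _ _ _ finsupp_lift finsupp_lift_linear.

Lemma finsupp_lift1 b c :
  finsupp_lift (finsupp_restrict [fset b] (fun=> c)) = h b c.
Proof.
rewrite (finsupp_liftE (D := [fset b])) => [|b' /negPf b'b].
  by rewrite big_seq_fset1 finsupp_restrictE fset11.
by rewrite finsupp_restrictE b'b.
Qed.

End Lift.

Section Submodule.
Variable S : submodClosed C.

Lemma finsupp_submod_closed :
  submod_closed [pred w : finsupp_fun | `[< forall b, w b \in S >]].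
Proof.
split=> [|a u v]; first by apply/asboolP => b; exact: rpred0.
move=> /asboolP Su /asboolP Sv; apply/asboolP => b.
exact: rpredD (rpredZ _ (Su b)) (Sv b).
Qed.

Definition finsupp_submod : submodClosed finsupp_fun :=
  submod_of finsupp_submod_closed.

Lemma finsupp_submodP w : reflect (forall b, w b \in S) (w \in finsupp_submod).
Proof. exact: asboolP. Qed.

End Submodule.

Lemma finsupp_submod_adjoin (S : submodClosed C) x :
  finsupp_submod (adjoin S x) =i adjoin (finsupp_submod S) x.
Proof.
move=> w; apply/idP/idP => [/finsupp_submodP|].
  have [D wD] := exists_supp w.
  move=> Sxw; have /choice[u Su] b := adjoinP _ _ _ (Sxw b).
  apply/adjoinP; exists (finsupp_restrict D u); apply/finsupp_submodP => b.
  rewrite -[X in X \in S]/(w b - x *: finsupp_restrict D u b).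
  rewrite finsupp_restrictE; case: ifPn => [_|/wD ->]; first exact: Su.
  by rewrite scaler0 subrr rpred0.
apply: adjoin_sub => [v /finsupp_submodP Sv|v]; apply/finsupp_submodP => b.
  exact: sub_adjoin.
exact: (mem_adjoin _ _ (v b)).
Qed.

Lemma weakly_regular_finsupp_submod (S : submodClosed C) xs :
  weakly_regular S xs -> weakly_regular (finsupp_submod S) xs.
Proof.
elim: xs S => [|x xs IH] S //= [Sx Sxs]; split.
  move=> w /finsupp_submodP Sw; apply/finsupp_submodP => b.
  exact/Sx/(Sw b).
exact: eq_weakly_regular (finsupp_submod_adjoin S x) (IH _ Sxs).
Qed.

Lemma weakly_regular_finsupp_fun xs : weakly_regular (ext_submod C [::]) xs ->
  weakly_regular (ext_submod finsupp_fun [::]) xs.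
Proof.
move=> /weakly_regular_finsupp_submod; apply: eq_weakly_regular => w.
rewrite ext_submod_nil; apply/finsupp_submodP/eqP => [w0|-> b].
  by apply: finsupp_funP => b; apply/eqP; rewrite -ext_submod_nil.
by rewrite ext_submod_nil.
Qed.

Lemma mem_finsupp_ext_submod ys w :
  (forall b, w b \in ext_submod C ys) -> w \in ext_submod finsupp_fun ys.
Proof.
move=> yw; have /choice[u Eu] b := asboolW (yw b); have [D wD] := exists_supp w.
apply/asboolP; exists (fun i => finsupp_restrict D (fun b => u b i)).
apply: finsupp_funP => b; rewrite -[RHS]/(coef b _) linear_sum.
under eq_bigr do rewrite linearZ_LR /= /coef finsupp_restrictE.
case: (boolP (b \in D)) => [_|/wD ->]; first exact: Eu.
by rewrite big1 // => i _; rewrite scaler0.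
Qed.

Lemma syzygies_in_ext_finsupp ys :
  syzygies_in_ext ys C -> syzygies_in_ext ys finsupp_fun.
Proof.
move=> syzC v yv0 i; apply: mem_finsupp_ext_submod => b.
apply: (syzC (fun i => v i b)); rewrite -[RHS](linear0 (coef b)) -yv0.
by rewrite linear_sum.
Qed.

End FinitelySupported.

Section FreeModule.
Variables (A : comNzRingType) (V : lmodType A) (V_free : is_free V).

Definition basis : V -> Prop := sval (cid V_free).

Lemma basisP : is_basis basis.
Proof. exact: svalP (cid V_free). Qed.

Definition basis_index : Type := {b : V | `[< basis b >]}.
HB.instance Definition _ := Choice.on basis_index.

Implicit Types b : basis_index.

Definition from_coords : finsupp_fun basis_index A^o -> V :=
  finsupp_lift (fun b => scale_at (val b)).

HB.instance Definition _ := GRing.Linear.on from_coords.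

Lemma basis_free (D : {fset basis_index}) (a : basis_index -> A) :
  \sum_(b <- D) a b *: val b = 0 -> forall b, b \in D -> a b = 0.
Proof.
move=> aD0 b bD; pose c v : A := if insub v is Some b' then a b' else 0.
have cE b' : c (val b') = a b' by rewrite /c valK.
rewrite -cE; apply: (basisP.2 [seq val b | b <- D]); last exact: map_f.
- by rewrite map_inj_uniq ?fset_uniq //; exact: val_inj.
- by move=> _ /mapP[b' _ ->]; exact/asboolP/(valP b').
- by rewrite -[RHS]aD0 big_map; apply: eq_bigr => b' _; rewrite cE.
Qed.

Lemma from_coords_inj : injective from_coords.
Proof.
apply: raddf_inj => w w0; apply: finsupp_funP => b.
have [D wD] := exists_supp w; have [bD|/wD //] := boolP (b \in D).
apply: (@basis_free D) bD.
by rewrite -[RHS]w0 /= /from_coords (finsupp_liftE _ wD).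
Qed.

Lemma from_coords1 b :
  from_coords (finsupp_restrict [fset b]%fset (fun=> 1)) = val b.
Proof. by rewrite /from_coords finsupp_lift1 /= scale1r. Qed.

Lemma from_coords_surj v : exists w, from_coords w = v.
Proof.
have [vs [vs_basis [c ->]]] := basisP.1 v.
pose bi (i : 'I_(size vs)) : basis_index :=
  exist _ vs`_i (asboolT (vs_basis _ (mem_nth 0 (ltn_ord i)))).
exists (\sum_i c i *: finsupp_restrict [fset bi i]%fset (fun=> 1)).
rewrite linear_sum; apply: eq_bigr => i _.
by rewrite linearZ_LR /= from_coords1.
Qed.

Definition coords v : finsupp_fun basis_index A^o :=
  sval (cid (from_coords_surj v)).

Lemma coordsK v : from_coords (coords v) = v.
Proof. exact: svalP (cid (from_coords_surj v)). Qed.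

Lemma from_coordsK w : coords (from_coords w) = w.
Proof. by apply: from_coords_inj; rewrite coordsK. Qed.

HB.instance Definition _ := GRing.isLinear.Build A _ _ _ coords
  (can2_linear from_coordsK coordsK).

Lemma free_lift (U W : lmodType A) (p : {linear U -> W}) (q : {linear V -> W}) :
  (forall v, exists u, p u = q v) ->
  exists g : {linear V -> U}, forall v, p (g v) = q v.
Proof.
move=> /choice[g0 pg0].
pose g : {linear finsupp_fun basis_index A^o -> U} :=
  finsupp_lift (fun b => scale_at (g0 (val b))).
exists (g \o coords) => v /=; have [D vD] := exists_supp (coords v).
rewrite -[in RHS](coordsK v) /= /from_coords !(finsupp_liftE _ vD) !linear_sum.
by apply: eq_bigr => b _; rewrite /= !linearZ_LR /= pg0.
Qed.

Section Tensor.
Variable C : lmodType A.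

Definition tensor : lmodType A := finsupp_fun basis_index C.

Lemma pure_tensor_supp v c :
  (fun b => (coords v b : A) *: c) \in @finsupp_pred A basis_index C.
Proof.
have [D vD] := exists_supp (coords v); apply/asboolP; exists D => b /vD ->.
exact: scale0r.
Qed.

Definition pure_tensor v c : tensor := FinsuppFun (pure_tensor_supp v c).

Lemma pure_tensor_bilinear : bilinear_for *:%R *:%R pure_tensor.
Proof.
split=> [c a u v|v a c c']; apply: finsupp_funP => b /=.
  by rewrite -[X in X *: c]/(coef b _) !linearP scalerDl -scalerA.
by rewrite addrfctE scalrfctE scalerDr !scalerA mulrC.
Qed.

HB.instance Definition _ := bilinear_isBilinear.Build A V C tensor *:%R *:%R
  pure_tensor pure_tensor_bilinear.

Lemma pure_tensor_basis b c :
  pure_tensor (val b) c = finsupp_restrict [fset b]%fset (fun=> c).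
Proof.
apply: finsupp_funP => b' /=; rewrite -from_coords1 from_coordsK.
by rewrite !finsupp_restrictE; case: ifP; rewrite ?scale1r ?scale0r.
Qed.

Lemma tensor_ind (S : submodClosed tensor) :
  (forall v c, pure_tensor v c \in S) -> forall w, w \in S.
Proof.
by move=> pureS; apply: finsupp_fun_ind => b c; rewrite -pure_tensor_basis.
Qed.

Lemma tensor_ext (U : lmodType A) (f g : {linear tensor -> U}) :
  (forall v c, f (pure_tensor v c) = g (pure_tensor v c)) -> f =1 g.
Proof.
move=> fg w; apply/eqP; rewrite -subr_eq0 -ext_submod_nil.
apply: (tensor_ind (S := preim_submod (f \- g) (ext_submod U [::]))) => v c.
by rewrite mem_preim_submod /= fg subrr ext_submod_nil.
Qed.

Section Lift.
Variables (U : lmodType A) (h : {bilinear V -> C -> U}).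

Definition tensor_lift : tensor -> U := finsupp_lift (fun b => h (val b)).

HB.instance Definition _ := GRing.Linear.on tensor_lift.

Lemma tensor_liftE v c : tensor_lift (pure_tensor v c) = h v c.
Proof.
have [D vD] := exists_supp (coords v).
rewrite /tensor_lift (finsupp_liftE _ (D := D)) => [|b /vD vb]; last first.
  by rewrite /= vb scale0r.
rewrite -[in RHS](coordsK v) /from_coords (finsupp_liftE _ vD) linear_sumlz.
by apply: eq_bigr => b _; rewrite /= linearZl_LR linearZr_LR.
Qed.

End Lift.
End Tensor.
End FreeModule.

Lemma functional_coordinates (A : comNzRingType) (V : lmodType A) (ys : seq A)
    (r : {linear V -> A^o}) :
  is_free V -> (forall v, r v \in ext_submod A^o ys) ->
  exists g : 'I_(size ys) -> {linear V -> A^o},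
    forall v, r v = \sum_(l < size ys) ys`_l *: g l v.
Proof.
move=> V_free r_ys.
have sum_lin : linear
    (fun a : 'I_(size ys) -> A^o => \sum_(l < size ys) ys`_l *: a l : A^o).
  move=> b a a'; rewrite scaler_sumr -big_split; apply: eq_bigr => l _.
  by rewrite /= scalerDr !scalerA mulrC.
have [v|g Eg] := free_lift V_free (p := linear_of sum_lin) (q := r).
  by have /asboolP[a ->] := r_ys v; exists a.
have coord_lin l : linear (fun v => g v l) by move=> a u v; rewrite linearP.
by exists (fun l => linear_of (coord_lin l)) => v; rewrite -Eg.
Qed.

Section TensorMap.
Variables (A : comNzRingType) (V W C : lmodType A).
Hypothesis V_free : is_free V.

Section BilinearComposition.
Variables (U : lmodType A) (h : {bilinear W -> C -> U}) (g : {linear V -> W}).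

Definition bilinear_comp v c := h (g v) c.

Lemma bilinear_comp_bilinear : bilinear_for *:%R *:%R bilinear_comp.
Proof.
split=> [c a u v|v a c c']; rewrite /bilinear_comp; last exact: linearPr.
by rewrite linearP linearPl.
Qed.

HB.instance Definition _ := bilinear_isBilinear.Build A V C U *:%R *:%R
  bilinear_comp bilinear_comp_bilinear.

End BilinearComposition.

Section Map.
Variables (W_free : is_free W) (g : {linear V -> W}).

Definition tensor_map : tensor V_free C -> tensor W_free C :=
  tensor_lift (bilinear_comp (pure_tensor W_free (C := C)) g).

HB.instance Definition _ := GRing.Linear.on tensor_map.

Lemma tensor_mapE v c :
  tensor_map (pure_tensor V_free v c) = pure_tensor W_free (g v) c.
Proof. exact: tensor_liftE. Qed.

End Map.
End TensorMap.

Section TensorFunctional.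
Variables (A : comNzRingType) (V C : lmodType A) (V_free : is_free V).

Definition scaling (a : A^o) (c : C) := a *: c.

Lemma scaling_bilinear : bilinear_for *:%R *:%R scaling.
Proof.
split=> [c|a b c c']; first exact: scale_linear.
by rewrite /scaling /= scalerDr !scalerA mulrC.
Qed.

HB.instance Definition _ :=
  bilinear_isBilinear.Build A A^o C C *:%R *:%R scaling scaling_bilinear.

Variable g : {linear V -> A^o}.

Definition tensor_functional : tensor V_free C -> C :=
  tensor_lift (bilinear_comp scaling g).

HB.instance Definition _ := GRing.Linear.on tensor_functional.

Lemma tensor_functionalE v c :
  tensor_functional (pure_tensor V_free v c) = (g v : A) *: c.
Proof. exact: tensor_liftE. Qed.

End TensorFunctional.

Section TensorComplex.
Variables (A : comNzRingType) (M : chain A) (M_free : forall i, is_free (M i)).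
Variable C : lmodType A.

Definition tensor_bdry i : tensor (M_free i.+1) C -> tensor (M_free i) C :=
  tensor_map (M_free i) bdry.

HB.instance Definition _ i := GRing.Linear.on (@tensor_bdry i).

Lemma pure_tensor_bdry i (v : M i.+1) c :
  tensor_bdry (pure_tensor _ v c) = pure_tensor _ (bdry v) c.
Proof. exact: tensor_mapE. Qed.

Lemma tensor_bdry_bdry i w : @tensor_bdry i (@tensor_bdry i.+1 w) = 0.
Proof.
apply: (tensor_ext (f := @tensor_bdry i \o @tensor_bdry i.+1) (g := \0)).
by move=> v c /=; rewrite !pure_tensor_bdry bdry_bdry linear0l.
Qed.

Definition tensor_chain : chain A := Chain tensor_bdry_bdry.

Definition tensor_pairing : chain_pairing C M tensor_chain :=
  @ChainPairing _ C M tensor_chain (fun i => pure_tensor (M_free i) (C := C))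
    pure_tensor_bdry.

Lemma tensor_eq0 i (w : tensor_chain i) : (forall v : M i, v = 0) -> w = 0.
Proof.
move=> M0; apply/eqP; rewrite -ext_submod_nil.
by apply: tensor_ind => v c; rewrite (M0 v) linear0l rpred0.
Qed.

Lemma tensor_functional_bdry ys i (g : {linear M i -> A^o})
    (w : tensor_chain i.+1) :
  (forall v : M i.+1, g (bdry v) \in ext_submod A^o ys) ->
  tensor_functional g (bdry w) \in ext_submod C ys.
Proof.
move=> gys.
pose f := (tensor_functional g : {linear tensor_chain i -> C}) \o bdry.
apply: (tensor_ind (S := preim_submod f (ext_submod C ys))) => v c.
rewrite mem_preim_submod /= pure_tensor_bdry tensor_functionalE.
exact: ext_submodZ.
Qed.

End TensorComplex.

(** * The bound on the embedding dimension *)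

Section EmbeddingDimension.
Variables (A : comNzRingType) (ys : seq A).
Local Notation n := (size ys).

Variables (M : chain A) (M_free : forall i, is_free (M i)).
Variables (e : M 0%N) (f : 'I_n -> M 1%N) (r : {linear M 0%N -> A^o}).
Hypothesis A_syz : syzygies_in_ext ys A^o.
Hypothesis bdry_f : forall l, bdry (f l) = ys`_l *: e.
Hypothesis r_e : (r e : A^o) - 1 \in ext_submod A^o ys.
Hypothesis r_bdry : forall v, r (bdry v) \in ext_submod A^o ys.
Hypothesis M_nil :
  forall x, x \in ext_submod A^o ys -> nilpotent_on_homology M x.
Variables (C : lmodType A) (xs : seq A).
Hypothesis xs_ys : {subset xs <= ext_submod A^o ys}.
Hypothesis C_reg : weakly_regular (ext_submod C [::]) xs.
Hypothesis M_big : forall i (v : M i), (size xs < i)%N -> v = 0.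

Let X := tensor_chain M_free C.
Let t := tensor_pairing M_free C.

Lemma exists_dual_homotopies : exists g : 'I_n -> {linear M 1%N -> A^o},
  (forall l (v : M 2%N), g l (bdry v) \in ext_submod A^o ys) /\
  (forall l j, g l (f j) - (l == j)%:R \in ext_submod A^o ys).
Proof.
have [g Eg] := functional_coordinates (r := r \o bdry) (M_free 1) r_bdry.
exists g; split=> [l v|l j].
  apply: (A_syz (v := fun l => g l (bdry v))).
  by rewrite -Eg /= bdry_bdry linear0.
apply: (submod_trans (v := (l == j)%:R * r e)).
  apply: (A_syz (v := fun l => g l (f j) - (l == j)%:R * r e)).
  under eq_bigr do rewrite scalerBr.
  rewrite sumrB -Eg /= bdry_f linearZ_LR (bigD1 j) //= eqxx mul1r big1.
    by rewrite addr0 subrr.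
  by move=> i /negPf ->; rewrite mul0r scaler0.
by rewrite -[X in _ - X]mulr1 -mulrBr; exact: rpredZ.
Qed.

Lemma koszul_tensor_exact_pos Ns :
  size Ns = size xs -> exact_pos (koszul_hom (pow_seq xs Ns) X).
Proof.
move=> sz_Ns; apply: koszul_hom_exact_pos => [i|i v].
  exact/weakly_regular_pow/weakly_regular_finsupp_fun.
by rewrite size_pow_seq // => lt_i; apply: tensor_eq0 => u; exact: M_big.
Qed.

Lemma koszul_lift_exact_pos : exists2 ps, exact_pos (koszul_hom ps X) &
  exists (p : koszul_hom ps M 0%N) (s : 'I_n -> koszul_hom ps M 1%N),
  [/\ koszul_eval p = e, forall l, koszul_eval (s l) = f l
    & forall l, bdry (s l) = ys`_l *: p].
Proof.
have nil x : x \in xs -> nilpotent_on_homology M x by move=> /xs_ys/M_nil.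
have [Ns sz_Ns lift] := koszul_lift bdry_f xs_ys nil.
by exists (pow_seq xs Ns) => //; exact: koszul_tensor_exact_pos.
Qed.

Lemma tensor_null_homotopies_boundary (c : 'I_n -> C) :
  \sum_(l < n) ys`_l *: c l = 0 ->
  exists w, \sum_(l < n) t 1%N (f l) (c l) = bdry w.
Proof.
move=> yc0; have [ps exX [p [s [_ evs ds]]]] := koszul_lift_exact_pos.
have [|w Ew] := exX _ (\sum_l koszul_pairing ps t _ (s l) (c l)).
  rewrite linear_sum -[RHS](linear0r (koszul_pairing ps t _) p) -yc0.
  rewrite linear_sumr.
  by apply: eq_bigr => l _; rewrite /= pairing_bdry ds linearZl_LR linearZr_LR.
exists (koszul_eval w); rewrite -koszul_eval_bdry -Ew linear_sum.
by apply: eq_bigr => l _; rewrite /= koszul_eval_pairing evs.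
Qed.

Lemma syzygies_in_ext_of_regular : syzygies_in_ext ys C.
Proof.
move=> c /tensor_null_homotopies_boundary[w Ew] l.
have [g [g_bdry g_f]] := exists_dual_homotopies.
have := tensor_functional_bdry w (g_bdry l); rewrite -Ew linear_sum /=.
rewrite (submod_congr (v := c l)) //.
have -> : c l = \sum_(j < n) (l == j)%:R *: c j.
  rewrite (bigD1 l) //= eqxx scale1r big1 ?addr0 // => j.
  by rewrite eq_sym => /negPf ->; rewrite scale0r.
rewrite -sumrB; apply: rpred_sum => j _.
by rewrite tensor_functionalE -scalerBl ext_submodZ.
Qed.

Theorem embedding_dim_le (c0 : C) :
  c0 \notin ext_submod C ys -> (n <= size xs)%N.
Proof.
move=> c0P; rewrite leqNgt; apply/negP => lt_n.
have [ps exX [p [s [evp _ ds]]]] := koszul_lift_exact_pos.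
pose tK := koszul_pairing ps t.
have dt l : bdry (tK 1%N (s l) c0) = ys`_l *: tK 0%N p c0.
  by rewrite pairing_bdry ds linearZl_LR.
have [P P0 ladderP] := exists_koszul_ladder (enum_uniq 'I_n) exX dt.
have X_syz i : syzygies_in_ext ys (X i).
  exact/syzygies_in_ext_finsupp/syzygies_in_ext_of_regular.
have [|w] := koszul_ladder_descent X_syz (koszul_ladder_eval ladderP).
  exists 0; rewrite [X in X \in _](_ : _ = 0) ?rpred0 //.
  by apply: tensor_eq0 => v; apply: M_big; rewrite size_enum_ord.
rewrite P0 koszul_eval_pairing evp.
pose rC : {linear X 0%N -> C} := tensor_functional r.
move=> /(linear_ext_submod rC); rewrite linearB /= => rC_e.
apply: (negP c0P); rewrite -(scale1r c0).
rewrite -(submod_congr (u := (r e : A) *: c0)).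
  rewrite -(tensor_functionalE (M_free 0)) (submod_congr rC_e).
  exact: tensor_functional_bdry.
by rewrite -scalerBl ext_submodZ.
Qed.

End EmbeddingDimension.

(** * Local rings *)

Section RedundantGenerator.
Variables (A : comNzRingType) (ys : seq A) (l : 'I_(size ys)).

Definition drop_generator : seq A :=
  [seq ys`_j | j : 'I_(size ys) <- enum (predC1 l)].

Lemma size_drop_generator : size drop_generator = (size ys).-1.
Proof. by rewrite size_map -cardE cardC1 card_ord. Qed.

Lemma mem_drop_generator (j : 'I_(size ys)) :
  j != l -> ys`_j \in drop_generator.
Proof.
by move=> jl; apply: (map_f (fun j : 'I_(size ys) => ys`_j)); rewrite mem_enum.
Qed.

Lemma ext_submod_drop_generator (c : 'I_(size ys) -> A^o) b (V : lmodType A) :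
  \sum_(i < size ys) ys`_i *: c i = 0 -> b * c l = 1 ->
  ext_submod V drop_generator =i ext_submod V ys.
Proof.
move=> yc0 bc1 v; apply/idP/idP.
  apply: ext_submod_sub => _ w /mapP[j _ ->].
  exact/mem_ext_submod/mem_nth.
apply: ext_submod_sub => y w /(nthP 0)[j lt_j <-].
have [jl|] := eqVneq (Ordinal lt_j) l; last first.
  by move=> /mem_drop_generator; exact: mem_ext_submod.
rewrite -[j]/(val (Ordinal lt_j)) jl; apply: ext_submodZ.
have -> : ys`_l = b *: (ys`_l *: c l).
  by rewrite -[RHS]/(b * (ys`_l * c l)) mulrCA bc1 mulr1.
apply: rpredZ; move: yc0; rewrite (bigD1 l) //= => /addr0_eq ylE.
rewrite -submodN ylE; apply: rpred_sum => i il.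
exact/mem_ext_submod/mem_drop_generator.
Qed.

End RedundantGenerator.

Section LocalRings.
Variables (A : comNzRingType) (m : idealr A).

Definition ideal_of (I : {pred A}) (I_closed : idealr_closed I) : idealr A :=
  HB.pack_for (idealr A) I (isIdealr.Build A I I_closed).

Section MaximalIdeal.
Local Open Scope classical_set_scope.
Variable I : idealr A.

(* Uniting with [I] makes the empty chain, too, have a proper ideal as union. *)
Definition ideal_cup (S : set A) : {pred A} := fun a => `[< a \in I \/ S a >].

Lemma sub_ideal_cup S : {subset I <= ideal_cup S}.
Proof. by move=> a Ia; apply/asboolP; left. Qed.

Lemma ideal_cup_mono (S T : set A) :
  S `<=` T -> {subset ideal_cup S <= ideal_cup T}.
Proof. by move=> ST a /asboolP[Ia|/ST Ta]; apply/asboolP; [left|right]. Qed.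

Lemma ideal_cup_chain_union (F : set (set A)) :
  (forall S, F S -> idealr_closed (ideal_cup S)) -> total_on F subset ->
  idealr_closed (ideal_cup (\bigcup_(S in F) S)).
Proof.
move=> F_ideal F_total; set U := \bigcup_(S in F) S.
have sub_U S : F S -> {subset ideal_cup S <= ideal_cup U}.
  by move=> FS; apply: ideal_cup_mono => a Sa; exists S.
have mem_U a : a \in ideal_cup U ->
    a \in I \/ exists2 S, F S & a \in ideal_cup S.
  move=> /asboolP[Ia|[S FS Sa]]; [by left|right; exists S => //].
  by apply/asboolP; right.
have combU a u v S : F S -> u \in ideal_cup S -> v \in ideal_cup S ->
    a * u + v \in ideal_cup U.
  by move=> FS Su Sv; apply: (sub_U S FS); have [_ _] := F_ideal S FS; apply.
split=> [||a u v].
- exact/sub_ideal_cup/rpred0.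
- apply/negP => /mem_U[|[S /F_ideal[_ /negP S1 _] /S1//]].
  by rewrite idealr1.
move=> /mem_U[Iu|[S FS Su]] /mem_U[Iv|[T FT Tv]].
- by apply: sub_ideal_cup; rewrite rpredD ?idealMr.
- by apply: combU FT _ Tv; exact: sub_ideal_cup.
- by apply: combU FS Su _; exact: sub_ideal_cup.
have [ST|TS] := F_total _ _ FS FT.
  exact: combU FT (ideal_cup_mono ST Su) Tv.
exact: combU FS Su (ideal_cup_mono TS Tv).
Qed.

Lemma exists_maximal_ideal :
  exists2 J : idealr A, maximal_ideal J & {subset I <= J}.
Proof.
have [S [S_ideal S_max]] := Zorn_bigcup ideal_cup_chain_union.
exists (ideal_of S_ideal) => [K SK a|]; last exact: sub_ideal_cup.
apply/idP/idP => [Ka|]; last exact: SK.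
apply: contrapT => Sa; apply: (S_max [set b | b \in K]).
  split=> [b Sb|KS]; first by apply: SK; apply/asboolP; right.
  by apply: Sa; apply/asboolP; right; exact: KS.
have cupK b : (b \in ideal_cup [set b | b \in K]) = (b \in K).
  apply/asboolP/idP => [[Ib|//]|]; last by right.
  exact/SK/sub_ideal_cup.
split=> [||c u v]; rewrite !cupK ?rpred0 ?idealr1 // => Ku Kv.
by rewrite rpredD ?idealMr.
Qed.

End MaximalIdeal.

Hypothesis A_local : local_ring m.

Lemma local_unit a : a \notin m -> exists b, b * a = 1.
Proof.
move=> am; apply: contrapT => a_nonunit.
have a_closed : idealr_closed (ext_submod A^o [:: a]).
  split=> [||b u v]; first exact: rpred0.
    apply/negP => /asboolP[u]; rewrite big_ord_recl big_ord0 addr0 /= => Eu.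
    by apply: a_nonunit; exists (u ord0); rewrite mulrC.
  by move=> ua va; rewrite rpredD // (rpredZ b ua).
have [J J_max aJ] := exists_maximal_ideal (ideal_of a_closed).
case/negP: am; rewrite -(A_local.2 J J_max).
exact/aJ/seq_sub_ext_submod/mem_head.
Qed.

Lemma scaler_fixed_eq0 (V : lmodType A) x (v : V) :
  x \in m -> x *: v = v -> v = 0.
Proof.
move=> xm xv; have [b b1x] : exists b, b * (1 - x) = 1.
  apply: local_unit; apply/negP => m1x.
  by have := idealr1 m; rewrite -(subrK x 1) rpredD.
by rewrite -(scale1r v) -b1x -scalerA scalerBl scale1r xv subrr scaler0.
Qed.

Section CyclicSubmodule.
Variables (V : lmodType A) (v : V).

Lemma cyclic_closed : submod_closed [pred w | `[< exists a, w = a *: v >]].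
Proof.
split=> [|c _ _ /asboolP[a ->] /asboolP[b ->]]; apply/asboolP.
  by exists 0; rewrite scale0r.
by exists (c * a + b); rewrite scalerDl scalerA.
Qed.

Definition cyclic_submod : submodClosed V := submod_of cyclic_closed.

Lemma cyclic_submodP w : reflect (exists a, w = a *: v) (w \in cyclic_submod).
Proof. exact: asboolP. Qed.

End CyclicSubmodule.

Lemma finite_length_nilpotent (V : lmodType A) x :
  finite_length V -> x \in m -> exists N, forall v : V, x ^+ N *: v = 0.
Proof.
move=> [N lenV] xm; exists N => v; apply: contrapT => xNv.
pose S i := cyclic_submod (x ^+ (N.+1 - i) *: v).
suff /lenV : strict_chain N.+1 S by rewrite ltnn.
move=> i lt_i; rewrite /S -(subnSK lt_i) subSS exprS -scalerA.
set w := x ^+ (N - i) *: v; split=> [_ /cyclic_submodP[a ->]|].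
  by apply/cyclic_submodP; exists (a * x); rewrite scalerA.
exists w; first by apply/cyclic_submodP; exists 1; rewrite scale1r.
apply/negP => /cyclic_submodP[a]; rewrite scalerA => /esym/scaler_fixed_eq0 w0.
apply: xNv; rewrite -(subnKC (lt_i : (i <= N)%N)) exprD -scalerA -/w.
by rewrite w0 ?scaler0 // idealMr.
Qed.

Lemma exists_minimal_generators : noetherian A ->
  exists2 ys : seq A, m =i ext_submod A^o ys & syzygies_in_ext ys A^o.
Proof.
move=> noeth.
pose generated n := `[< exists2 ys : seq A,
  size ys = n & m =i ext_submod A^o ys >].
have ex_generated : exists n, generated n.
  have [xs xsP] := noeth (GRing.SubmodClosed.clone A A^o (ideal_pred m) _).
  exists (size xs); apply/asboolP; exists xs => // a.
  by apply/idP/idP => [/xsP/gen_idealP|/gen_idealP/xsP].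
case: (ex_minnP ex_generated) => _ /asboolP[ys <- ysP] ys_min; exists ys => //.
move=> c yc0 l; rewrite -ysP; apply: contrapT => /negP cl_notin.
have [b bc1] : exists b, b * c l = 1 by apply: local_unit.
suff /ys_min : generated (size ys).-1.
  by rewrite leqNgt ltn_predL (leq_ltn_trans (leq0n l)).
rewrite -(size_drop_generator l); apply/asboolP.
exists (drop_generator l) => // a.
by rewrite ysP; apply/esym/(ext_submod_drop_generator yc0 bc1).
Qed.

End LocalRings.

Lemma nilpotent_nakayama (A : comNzRingType) (V : lmodType A)
    (S : submodClosed V) (zs : seq A) :
  (forall z, z \in zs -> exists N, forall v : V, z ^+ N *: v \in S) ->
  (forall v, exists2 u, u \in ext_submod V zs & v - u \in S) ->
  forall v, v \in S.
Proof.
elim: zs S => [|z zs IH] S nil full v.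
  by have [u] := full v; rewrite ext_submod_nil => /eqP ->; rewrite subr0.
have zfull u : u \in adjoin S z.
  apply: IH u => [z' zs_z'|u].
    have [|N zN] := nil z'; first by rewrite inE zs_z' orbT.
    by exists N => u; exact: sub_adjoin.
  have [u' + Suu'] := full u; rewrite -(@adjoin_ext_submod _ _ z zs) //.
  move=> /adjoinP[w zs_u']; exists (u' - z *: w) => //.
  by rewrite opprB addrCA rpredD ?mem_adjoin //; exact: sub_adjoin.
have zpow_full k : exists w, v - z ^+ k *: w \in S.
  elim: k => [|k [w Sw]]; first by exists v; rewrite scale1r subrr rpred0.
  have /adjoinP[w' Sw'] := zfull w; exists w'; apply: submod_trans Sw _.
  by rewrite exprSr -scalerA -scalerBr rpredZ.
have [N zN] := nil z (mem_head _ _); have [w /submod_congr ->] := zpow_full N.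
exact: zN.
Qed.

Lemma exists_notin_ext_submod (A : comNzRingType) (m : idealr A)
    (C : lmodType A) (xs ys : seq A) :
  {subset ys <= m} -> system_of_parameters m xs ->
  (exists c : C, c \notin ext_pred xs) ->
  exists c : C, c \notin ext_submod C ys.
Proof.
move=> ys_m [_ _ m_pow] [c c_xs]; apply: contrapT => all_ys.
case/negP: c_xs; apply: (nilpotent_nakayama (S := ext_submod C xs) (zs := ys)).
  move=> y /ys_m/m_pow[N yN]; exists N => v; apply: ext_submodZ.
  exact/gen_idealP.
move=> v; exists v; last by rewrite subrr rpred0.
by apply: contrapT => /negP v_ys; apply: all_ys; exists v.
Qed.

Lemma direct_summand_retract (A : pzRingType) (U V : lmodType A) :
  direct_summand U V ->
  exists (i : {linear U -> V}) (p : {linear V -> U}), cancel i p.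
Proof.
move=> [N [f [g fK gK]]].
pose gL := linear_of (can2_linear fK gK).
have inl_lin : linear (fun u : U => (u, 0) : (U * N)%type).
  by move=> a u v; congr (_, _); rewrite /= scaler0 addr0.
by exists (f \o linear_of inl_lin), (fst \o gL) => u /=; rewrite fK.
Qed.

Section KerModIm.
Variables (A : comNzRingType) (U V W : lmodType A).
Variables (f : {linear U -> V}) (g : {linear V -> W}).

Lemma ker_mod_im_nilpotent (m : idealr A) x :
  local_ring m -> finite_length (ker_mod_im f g) ->
  x \in m -> exists N, forall z, g z = 0 -> exists u, x ^+ N *: z = f u.
Proof.
move=> A_local lenH xm; have [N xN] := finite_length_nilpotent A_local lenH xm.
exists N => z gz; have kz : z \in ker_pred g by apply/eqP.
have /eqP := xN (quot_pi _ (Cycle kz)); rewrite -linearZ_LR quot_pi_eq0.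
by move=> /asboolP[u fu]; exists u; rewrite fu.
Qed.

Hypothesis g0 : forall v, g v = 0.

Lemma ker_pred_full v : v \in ker_pred g.
Proof. exact/eqP/g0. Qed.

Definition homology_class (v : V) : ker_mod_im f g :=
  quot_pi _ (Cycle (ker_pred_full v)).

Lemma homology_class_linear : linear homology_class.
Proof.
move=> a u v; rewrite /homology_class -linearP; congr quot_pi.
exact: val_inj.
Qed.

HB.instance Definition _ := GRing.isLinear.Build A _ _ _ homology_class
  homology_class_linear.

Lemma homology_class_eq0 v : homology_class v = 0 <-> exists u, f u = v.
Proof.
split=> [/eqP|fu]; first by rewrite quot_pi_eq0 => /asboolP.
by apply/eqP; rewrite quot_pi_eq0; exact/asboolP.
Qed.

Lemma homology_class_surj h : exists v, homology_class v = h.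
Proof.
have [[v kv] <-] := quot_pi_surj h; exists v.
by congr quot_pi; exact: val_inj.
Qed.

End KerModIm.

(* [e] lifts a generator of the summand k of H = V/f(U), and [r] lifts the
   projection V -> H -> k to A. *)
Lemma residue_summand_lift (A : comNzRingType) (m : idealr A)
    (U V H : lmodType A) (f : {linear U -> V}) (q : {linear V -> H})
    (ys : seq A) :
  is_free V -> (forall h, exists v, q v = h) ->
  (forall v, q v = 0 <-> exists u, f u = v) ->
  m =i ext_submod A^o ys ->
  direct_summand (residue_field m) H ->
  exists (e : V) (h : 'I_(size ys) -> U) (r : {linear V -> A^o}),
  [/\ forall l, f (h l) = ys`_l *: e, (r e : A^o) - 1 \in ext_submod A^o ys
    & forall u, r (f u) \in ext_submod A^o ys].
Proof.
move=> V_free q_surj q_eq0 ysP /direct_summand_retract[i [p ipK]].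
pose pi : {linear A^o -> residue_field m} :=
  quot_pi (GRing.SubmodClosed.clone A A^o (ideal_pred m) _).
have pi_eq0 (a : A^o) : reflect (pi a = 0) (a \in ext_submod A^o ys).
  rewrite -ysP; apply: (iffP idP) => [am|/eqP]; last by rewrite quot_pi_eq0.
  by apply/eqP; rewrite quot_pi_eq0.
have [e Ee] := q_surj (i (pi 1)).
have /choice[h Eh] (l : 'I_(size ys)) : exists u, f u = ys`_l *: e.
  apply/q_eq0; rewrite linearZ_LR /= Ee -!linearZ_LR.
  have -> : pi (ys`_l *: 1) = 0 by apply/pi_eq0/mem_ext_submod/mem_nth.
  by rewrite linear0.
have [v|r Er] := free_lift V_free (p := pi) (q := p \o q).
  exact: quot_pi_surj.
exists e, h, r; split=> // [|u]; apply/pi_eq0.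
  by rewrite linearB Er /= Ee ipK subrr.
by rewrite Er /= (_ : q (f u) = 0) ?linear0 //; apply/q_eq0; exists u.
Qed.

Lemma krull_dim_uniq (A : comNzRingType) d d' :
  krull_dim A d -> krull_dim A d' -> d = d'.
Proof.
move=> [[P Pd] dmax] [[P' Pd'] dmax']; apply/eqP; rewrite eqn_leq.
by rewrite (dmax' _ _ Pd) (dmax _ _ Pd').
Qed.

Lemma regular_local_of_few_generators (A : comNzRingType) (m : idealr A) d
    (ys : seq A) : krull_dim A d -> (size ys <= d)%N ->
  m =i ext_submod A^o ys -> regular_local m.
Proof.
move=> dimA le_ys_d ysP; exists (ys ++ nseq (d - size ys) 0).
rewrite size_cat size_nseq subnKC //; split=> // a.
rewrite gen_idealP ysP; split; apply: ext_submod_sub => y v.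
  by move=> ys_y; rewrite mem_ext_submod // mem_cat ys_y.
rewrite mem_cat mem_nseq => /orP[|/andP[_ /eqP ->]].
  exact: mem_ext_submod.
by rewrite scale0r rpred0.
Qed.

Definition nonneg_chain (A : comNzRingType) (M : complex A) : chain A :=
  @Chain A (fun i => M i%:Z) (fun i => diff M i.+1%:Z i%:Z)
    (fun i x => diff_diff (c := M) _ _ x).

Lemma nonneg_chain_nilpotent (A : comNzRingType) (m : idealr A)
    (M : complex A) x :
  local_ring m -> (forall i : int, 1 <= i -> finite_length (homology M i)) ->
  x \in m -> nilpotent_on_homology (nonneg_chain M) x.
Proof.
move=> A_local H_length xm i; have := H_length i.+1%:Z isT; rewrite /homology.
have -> : i.+1%:Z + 1 = i.+2%:Z by rewrite -PoszD addn1.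
have -> : i.+1%:Z - 1 = i%:Z by rewrite intS addrC addKr.
by move=> /(ker_mod_im_nilpotent A_local)/(_ xm).
Qed.

Theorem theorem2p4 (A : comNzRingType) (m : idealr A)
  (A_noeth : noetherian A) (A_local : local_ring m)
  (d : nat) (dimA : krull_dim A d)
  (M : complex A)
  (M_free : forall i, is_free (M i))
  (M_bounded : forall i : int, ~~ (0 <= i <= d%:Z) -> forall x : M i, x = 0)
  (H0_fg : fin_gen (homology M 0))
  (Hi_length : forall i : int, 1 <= i -> finite_length (homology M i))
  (A_bigCM : exists C : lmodType A, big_cohen_macaulay m C)
  (k_summand : direct_summand (residue_field m) (homology M 0)) :
  regular_local m.
Proof.
have [ys ysP A_syz] := exists_minimal_generators A_local A_noeth.
have [C [xs [sop_xs C_reg]]] := A_bigCM.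
have [dim_xs xs_m _] := sop_xs; have Ed := krull_dim_uniq dimA dim_xs.
apply: (regular_local_of_few_generators dimA _ ysP); rewrite Ed.
have bdry0 (v : M 0) : diff M 0 (0 - 1) v = 0 by apply: M_bounded.
have [e [f [r [df_f r_e r_df]]]] := residue_summand_lift (M_free 0)
  (homology_class_surj bdry0) (homology_class_eq0 _ bdry0) ysP k_summand.
have M_nil x :
    x \in ext_submod A^o ys -> nilpotent_on_homology (nonneg_chain M) x.
  by rewrite -ysP; exact: nonneg_chain_nilpotent.
have M_big i (v : nonneg_chain M i) : (size xs < i)%N -> v = 0.
  move=> lt_i; apply: M_bounded.
  by rewrite negb_and Ed lez_nat -ltnNge lt_i orbT.
have ys_m : {subset ys <= m} by move=> y /seq_sub_ext_submod; rewrite -ysP.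
have [c0 c0P] := exists_notin_ext_submod ys_m sop_xs C_reg.1.
apply: (embedding_dim_le (M := nonneg_chain M) (fun i => M_free i%:Z) A_syz
  df_f r_e r_df M_nil _ (regular_sequence_weakly_regular C_reg) M_big c0P).
by move=> x /xs_m; rewrite ysP.
Qed.
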